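(* Let $T>0$ be a prescribed number and let $\alpha\in(0,1)$. Then the closed-loop system consisting of the scalar system $$\dot{x}(t)=u(t),\quad x(0)=x_0,\quad x(t)\in\mathbf{R},\ u(t)\in\mathbf{R},\quad t\ge 0,$$ and the control law $$u(t)=-\frac{\pi}{2^{1-\alpha/2}\alpha T}\,\mathrm{sig}^{1-\alpha}(x(t))\,\varepsilon(t),\qquad \dot{\varepsilon}(t)=\frac{\pi}{2^{1+\alpha/2}T}\,|x(t)|^{\alpha},\quad \varepsilon(0)=0,$$ is exact fixed-time stable (EFxTS) with the settling time $T$.
   Context: Notation: for $z\in\mathbf{R}$ and $\alpha\in(0,\infty)$, $\mathrm{sig}^{\alpha}(z)=|z|^{\alpha}\mathrm{sign}(z)$, where $\mathrm{sign}$ is the sign function. General setting: consider $\dot x(t)=f(t,x(t),\varepsilon(t))$, $x(0)=x_0$, $t\ge 0$, with state $x(t)\in\mathbf{R}^n$, coupled with $\dot\varepsilon(t)=g(t,x(t))$, $\varepsilon(0)=\varepsilon_0$, $\varepsilon(t)\in\mathbf{R}^m$, where $f,g$ are locally essentially bounded and locally measurable, and $x=0$ is an equilibrium of the $x$-system. Here $\varepsilon$ is an auxiliary controller variable with the specified initial value $\varepsilon_0$; stability refers only to the component $x$. Solutions are understood in the sense of Filippov (absolutely continuous solutions $\xi=[x^{\mathrm T},\varepsilon^{\mathrm T}]^{\mathrm T}$ of the Filippov differential inclusion associated with the right-hand side), and stability is strong stability, i.e., it concerns all solutions. Definitions. The $x$-system is: - finite-time stable (FTS) if it is globally stable (in the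 sense of Lyapunov) and there is a function $T_0:\mathbf{R}^n\to[0,\infty)$ such that $x(t)=0$ for all $t\ge T_0(x_0)$; - fixed-time stable (FxTS) with the settling time $T<\infty$ if it is FTS and $T_0(x_0)\le T$ for all $x_0$; - exact fixed-time stable (EFxTS) with the settling time $T<\infty$ if it is FxTS and $T_0(x_0)=T$ for all $x_0\neq 0$, where $T_0(x_0)$ is the actual settling time, i.e., for $x_0\ne0$ each solution satisfies $\inf\{\tau\ge 0: x(t)=0\ \forall t\ge\tau\}=T$. *)

(* Defs.v *)
From HB Require Import structures.
From mathcomp Require Import all_boot all_order all_algebra.
From mathcomp Require Import all_classical all_reals all_analysis.

Set Implicit Arguments.
Unset Strict Implicit.
Unset Printing Implicit Defensive.
Import Order.TTheory GRing.Theory Num.Theory.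
Import numFieldNormedType.Exports.
Local Open Scope classical_set_scope.
Local Open Scope ring_scope.

Definition sig (R : realType) (a z : R) : R := `|z| `^ a * Num.sg z.

(* Absolute continuity on [a, b].  Reordering a finite family of intervals does
   not affect the sums, so families are given as sequences of pairs of
   endpoints. *)
Definition abs_continuous (R : realType) (V : normedModType R) (a b : R)
    (h : R -> V) : Prop :=
  forall e : R, 0 < e -> exists2 d : R, 0 < d &
    forall s : seq (R * R),
      (forall I, I \in s -> [/\ a <= I.1, I.1 <= I.2 & I.2 <= b]) ->
      pairwise (fun I J : R * R => (I.2 <= J.1) || (J.2 <= I.1)) s ->
      \sum_(I <- s) (I.2 - I.1) < d ->
      \sum_(I <- s) `|h I.2 - h I.1| < e.

Definition closed_convex_hull (R : realType) (V : normedModType R)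
    (A : set V) : set V :=
  smallest [set C : set V | closed C /\ convex_set C] A.

(* The sup-norm balls of R * R give the same intersection as Euclidean ones. *)
Definition filippov_map (R : realType) (h : R * R -> R * R) (p : R * R) :
    set (R * R) :=
  \bigcap_(d in [set d : R | 0 < d])
  \bigcap_(N in [set N : set (R * R) |
      ((@lebesgue_measure R) \x (@lebesgue_measure R))%E.-negligible N])
    closed_convex_hull (h @` (ball p d `\` N)).

(* For x' = f(t, x, eps), eps' = g(t, x) with scalar x and eps: xi = (x, eps) is
   a Filippov solution on [0, b[ (b possibly infinite) from (x0, eps0).  The
   values of xi outside [0, b[ play no role; the two-sided derivative at 0 is
   irrelevant since {0} is a null set. *)
Definition filippov_solution (R : realType) (f : R -> R -> R -> R)
    (g : R -> R -> R) (eps0 x0 : R) (b : \bar R) (xi : R -> R * R) : Prop :=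
  [/\ (0 < b)%E,
      xi 0 = (x0, eps0),
      forall c : R, 0 <= c -> (c%:E < b)%E -> abs_continuous 0 c xi &
      {ae @lebesgue_measure R, forall t : R, 0 <= t -> (t%:E < b)%E ->
         exists2 v : R * R, is_derive t 1 xi v &
           filippov_map (fun p => (f t p.1 p.2, g t p.1)) (xi t) v}].

(* The initial value eps0 is part of the system, so only x0 varies below. *)

Definition global_solution (R : realType) f g (eps0 x0 : R) xi : Prop :=
  filippov_solution f g eps0 x0 +oo%E xi.

(* Global solutions exist for every x0, and every solution on a bounded
   interval [0, b[ continues to one: quantifying over global solutions thus
   covers all solutions, and never vacuously. *)
Definition forward_complete (R : realType) f g (eps0 : R) : Prop :=
  (forall x0 : R, exists xi, global_solution f g eps0 x0 xi) /\
  (forall (x0 b : R) xi, filippov_solution f g eps0 x0 b%:E xi ->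
     exists2 xi', global_solution f g eps0 x0 xi' &
       forall t : R, 0 <= t < b -> xi' t = xi t).

(* Lyapunov stability of x = 0, together with uniform boundedness of the
   solutions starting in an arbitrary ball ("globally"); this is the usual
   class K-infinity bound |x(t)| <= kappa(|x0|). *)
Definition globally_stable (R : realType) f g (eps0 : R) : Prop :=
  (forall e : R, 0 < e -> exists2 d : R, 0 < d &
     forall x0 xi, `|x0| < d -> global_solution f g eps0 x0 xi ->
       forall t : R, 0 <= t -> `|(xi t).1| < e) /\
  (forall r : R, 0 < r -> exists2 M : R, 0 < M &
     forall x0 xi, `|x0| < r -> global_solution f g eps0 x0 xi ->
       forall t : R, 0 <= t -> `|(xi t).1| < M).

Definition FTS_with (R : realType) f g (eps0 : R) (T0 : R -> R) : Prop :=
  [/\ forward_complete f g eps0,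
      globally_stable f g eps0,
      forall x0 : R, 0 <= T0 x0 &
      forall x0 xi, global_solution f g eps0 x0 xi ->
        forall t : R, T0 x0 <= t -> (xi t).1 = 0].

Definition FTS (R : realType) f g (eps0 : R) : Prop :=
  exists T0 : R -> R, FTS_with f g eps0 T0.

Definition FxTS_with (R : realType) f g (eps0 : R) T0 (T : R) : Prop :=
  FTS_with f g eps0 T0 /\ forall x0, T0 x0 <= T.

Definition FxTS (R : realType) f g (eps0 T : R) : Prop :=
  exists T0 : R -> R, FxTS_with f g eps0 T0 T.

Definition settling_time (R : realType) (xi : R -> R * R) : R :=
  inf [set tau : R | 0 <= tau /\ forall t, tau <= t -> (xi t).1 = 0].

Definition EFxTS (R : realType) f g (eps0 T : R) : Prop :=
  exists T0 : R -> R,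
    FxTS_with f g eps0 T0 T /\
    forall x0, x0 != 0 ->
      T0 x0 = T /\
      forall xi, global_solution f g eps0 x0 xi -> settling_time xi = T.

(* Main.v *)
(* Away from x = 0, y = |x|^alpha and eps obey the linear system
   y' = - alpha k1 eps, eps' = k2 y with alpha k1 k2 = (pi / (2 T))^2, so that
   y = |x0|^alpha cos (pi t / (2 T)), which first vanishes at t = T.  Since
   eps >= 0, |x| never increases, hence x stays at 0 from then on.  Solutions are
   therefore unique and explicit, which also yields existence and continuation.
   The right-hand side being continuous, the Filippov map is single-valued, and
   an absolutely continuous solution is differentiable at every interior time. *)
Require Import Defs.
From HB Require Import structures.
From mathcomp Require Import all_boot all_order all_algebra.
From mathcomp Require Import all_classical all_reals all_analysis.
From mathcomp Require Import measurable_realfun ring lra.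
Set Implicit Arguments.
Unset Strict Implicit.
Unset Printing Implicit Defensive.
Import Order.TTheory GRing.Theory Num.Theory.
Import numFieldNormedType.Exports.
Local Open Scope classical_set_scope.
Local Open Scope ring_scope.

(** * Absolutely continuous functions *)

(** Neither |x|^alpha nor sig^(1 - alpha) is Lipschitz at 0, so uniqueness cannot come from a
    Lipschitz condition and has to come from the structure of the loop. The obstacle is circularity:
    the linear system holds only while x is nonzero, and where x vanishes is what has to be found.
    Monotonicity of |x| breaks the circle: if x is nonzero at t, it is nonzero on all of [0, t], and
    a zero is never left again. A zero before T is then excluded by continuity. The frequency of a
    linear oscillator does not depend on its amplitude |x0|^alpha, which is why the settling time is
    the same for every nonzero x0; the initial value 0 of eps fixes the phase, so that T is exactly
    a quarter period. The passage from almost every time to every interior time uses a mean value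
    inequality for absolutely continuous functions, proved by a covering argument rather than by
    integration. *)

(** Both increments are compared with the tag t; since u <= t <= w, the two lengths add up to w - u.
    This is what permits working with differentiability at the single point t. *)
Lemma is_derive_straddle (R : realType) (V : normedModType R) (h : R -> V)
    (t M e : R) (v : V) : is_derive t 1 h v -> `|v| <= M -> 0 < e ->
  exists2 r, 0 < r & forall u w, t - r < u <= t -> t <= w < t + r ->
    `|h w - h u| <= (M + e) * (w - u).
Proof.
move=> [hd hv] vM e0.
have M0 : 0 <= M by exact: le_trans vM.
have : k^-1 *: (h (k *: 1 + t) - h t) @[k --> 0^'] --> v by rewrite -hv; exact: hd.
move=> /cvgrPdist_le/(_ e e0).
rewrite near_withinE -[nbhs _]/(nbhs (0:R)) => /nbhs_ballP[r /= r0 rh].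
have step k : `|k| < r -> `|h (k + t) - h t| <= (M + e) * `|k|.
  move=> kr; have [->|k0] := eqVneq k 0.
    by rewrite add0r subrr !normr0 mulr0.
  have := rh k; rewrite /ball/= sub0r normrN => /(_ kr k0).
  rewrite -[_ *: 1]/(k * 1) mulr1 => hk.
  have : `|k^-1 *: (h (k + t) - h t)| <= M + e.
    rewrite -[X in `|X|](subrK v) (le_trans (ler_normD _ _))// addrC lerD//.
    by rewrite distrC.
  by rewrite normrZ normfV ler_pdivrMl ?normr_gt0// mulrC.
exists r => // u w /andP[ru ut] /andP[tw wr].
have := step (w - t); have := step (u - t); rewrite !subrK.
rewrite ler0_norm ?subr_le0// ger0_norm ?subr_ge0//.
move=> /(_ ltac:(lra)) hu /(_ ltac:(lra)) hw.
rewrite -(subrK (h t) (h w)) -addrA (le_trans (ler_normD _ _))//.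
rewrite (distrC (h t)) (le_trans (lerD hw hu))//; lra.
Qed.

(* Cousin's lemma on tagged partitions, stated as an induction principle. *)
Lemma straddle_induction (R : realType) (a b : R) (P : set R) : a <= b -> P a ->
  (forall t, a <= t <= b -> exists2 r, 0 < r &
     forall u w, a <= u -> w <= b -> t - r < u <= t -> t <= w < t + r ->
       P u -> P w) ->
  P b.
Proof.
move=> ab Pa step; pose S := [set c | a <= c <= b /\ P c].
have Sa : S a by split=> //; rewrite lexx.
have Sb : ubound S b by move=> c [/andP[]].
have supS : has_sup S by split; [exists a|exists b].
have aS : a <= sup S by exact: (ub_le_sup supS.2 Sa).
have Sb' : sup S <= b by exact: (ge_sup supS.1 Sb).
have [|r r0 {}step] := step (sup S); first by rewrite aS.
(* The step jumps from u, just left of the supremum, across it to w; [P] at the supremum itself is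
   not presupposed, so [P] need not be closed under limits. *)
have [u [/andP[au ub] Pu] ru] := sup_adherent r0 supS.
have uS : u <= sup S by apply: (ub_le_sup supS.2); split=> //; rewrite au.
have Pw w : w <= b -> sup S <= w < sup S + r -> P w.
  by move=> wb Sw; apply: (step u) => //; rewrite ru uS.
have [bS|Sltb] := leP b (sup S + r / 2).
  by apply: Pw => //; rewrite Sb'/=; lra.
have : S (sup S + r / 2).
  split; first by rewrite (ltW Sltb) andbT; lra.
  by apply: Pw; [exact: ltW|lra].
by move/(ub_le_sup supS.2); lra.
Qed.

(* The exceptional null set is covered by an open set of small measure, on which
   absolute continuity controls the increments; elsewhere the derivative does. *)
Lemma abs_continuous_mean_value (R : realType) (V : normedModType R)
    (h : R -> V) (a b M : R) : a <= b -> 0 <= M -> abs_continuous a b h ->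
  {ae @lebesgue_measure R, forall t, a <= t -> t <= b ->
     exists2 v, is_derive t 1 h v & `|v| <= M} ->
  `|h b - h a| <= M * (b - a).
Proof.
move=> ab M0 hAC [N [mN N0 hN]].
pose mu : measure _ _ := @lebesgue_measure R.
rewrite -[lebesgue_measure N]/(mu N) in N0.
apply/ler_addgt0Pr => e e0.
(* Half of e pays for the slack e1 (b - a) of the derivative bound, half for the increments on the
   null set; the added 1 covers the case a = b. *)
pose e1 := e / 2 / (b - a + 1).
have e10 : 0 < e1 by rewrite !divr_gt0//; lra.
have [d d0 hd] := hAC _ (ltac:(lra) : 0 < e / 2).
have [U [oU NU Ud]] : exists U : set R,
    [/\ open U, N `<=` U & (mu U < d%:E)%E].
  have [|U [oU NU Ud]] := lebesgue_regularity_outer mN _ d0; first by rewrite N0.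
  exists U; split=> //.
  have mU : measurable U by exact: open_measurable.
  have -> : mu U = (mu (U `\` N) + mu N)%E.
    by rewrite -[X in (_ + mu X)%E](setIidr NU); exact: measureDI.
  by rewrite N0 adde0.
have mU : measurable U by exact: open_measurable.
(* The increments that the derivative does not control are collected in [s],
   whose total length stays below [d]. *)
pose P := [set c : R | exists s : seq (R * R),
  [/\ forall I, I \in s -> [/\ a <= I.1, I.1 <= I.2 & I.2 <= c],
      pairwise (fun I J : R * R => (I.2 <= J.1) || (J.2 <= I.1)) s,
      ((\sum_(I <- s) (I.2 - I.1))%:E <= mu (U `&` `[a, c[))%E &
      `|h c - h a| <= (M + e1) * (c - a) + \sum_(I <- s) `|h I.2 - h I.1| ]].
have [||s [sab sp slen hs]] := @straddle_induction R a b P ab.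
- exists [::]; split=> //; first by rewrite big_nil measure_ge0.
  by rewrite !subrr normr0 mulr0 big_nil addr0.
- move=> t /andP[at_ tb].
  have Msub u w s1 s2 (s := \sum_(I <- s1) `|h I.2 - h I.1|)
      (s' := \sum_(I <- s2) `|h I.2 - h I.1|) :
      `|h u - h a| <= (M + e1) * (u - a) + s ->
      `|h w - h u| <= (M + e1) * (w - u) + s' ->
      `|h w - h a| <= (M + e1) * (w - a) + (s' + s).
    move=> hu hw; rewrite -(subrK (h u) (h w)) -addrA.
    rewrite (le_trans (ler_normD _ _))// (le_trans (lerD hw hu))//; lra.
  have mI (c : R) : measurable (U `&` `[a, c[) by exact: measurableI.
  have [Nt|Nt] := pselect (N t).
    have /nbhs_ballP[r/= r0 rU] := open_nbhs_nbhs (conj oU (NU _ Nt)).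
    exists r => // u w au wb /andP[ru ut] /andP[tw wr] [s [sau sp slen hs]].
    exists ((u, w) :: s); split.
    + move=> I; rewrite inE => /predU1P[->/=|/sau[]]; first by split=> //; lra.
      by move=> *; split=> //; lra.
    + rewrite /= sp andbT; apply/allP => I /sau[_ _ Iu]/=.
      by rewrite Iu orbT.
    (* The half-open intervals [a, u[ and [u, w[ are disjoint, and [u, w[ lies in U by the choice of
       r, so the measures add up inside U and [a, w[. *)
    + rewrite big_cons/= EFinD.
      rewrite (_ : (w - u)%:E = mu `[u, w[%classic); last first.
        apply/esym/(etrans (lebesgue_measure_itv _)); rewrite /= lte_fin.
        by case: ltP => // wu; congr (_%:E); lra.
      apply: (le_trans (leeD2l _ slen)).
      rewrite -measureU//; [|exact: mI|]; last first.
        by rewrite -subset0 => z []/=; rewrite in_itv/= => /andP[? ?] [_];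
          rewrite in_itv/= => /andP[? ?]; lra.
      apply: le_measure; rewrite ?inE//;
        [by apply: measurableU => //; exact: mI|exact: mI|].
      move=> z []; rewrite /= ?in_itv/=.
        move=> /andP[uz zw]; split; last by rewrite zw (le_trans au).
        by apply: rU; rewrite /ball/= ltr_norml; lra.
      by move=> [Uz /andP[? ?]]; split=> //; lra.
    + rewrite big_cons; move: (Msub u w s [:: (u, w)] hs).
      rewrite big_seq1/=; apply; rewrite lerDr mulr_ge0//; lra.
  have [v hv vM] : exists2 v, is_derive t 1 h v & `|v| <= M.
    by apply: contrapT => hn; apply/Nt/hN => /=; apply/not_implyP; split=> //;
      apply/not_implyP.
  have [r r0 hr] := is_derive_straddle hv vM e10.
  exists r => // u w au wb ut tw [s [sau sp slen hs]].
  have uw : u <= w by lra.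
  exists s; split=> //.
  + by move=> I /sau[? ? ?]; split=> //; lra.
  + apply: (le_trans slen); apply: le_measure; rewrite ?inE//;
      [exact: mI|exact: mI|] => z [Uz].
    by rewrite /= !in_itv/= => /andP[az zu]; split=> //; lra.
  + move: (Msub u w s [::] hs); rewrite big_nil !add0r addr0; apply; exact: hr.
have {}slen : \sum_(I <- s) (I.2 - I.1) < d.
  rewrite -lte_fin (le_lt_trans slen)// (le_lt_trans _ Ud)//.
  by apply: le_measure; rewrite ?inE//; exact: measurableI.
have := hd s sab sp slen.
have : e1 * (b - a) <= e / 2.
  rewrite /e1 -mulrA ler_piMr//; first lra.
  by rewrite ler_pdivrMl; lra.
lra.
Qed.

Lemma abs_continuous_sub (R : realType) (V : normedModType R) (h : R -> V)
    (a b a' b' : R) : a <= a' -> b' <= b ->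
  abs_continuous a b h -> abs_continuous a' b' h.
Proof.
move=> aa bb hAC e /hAC[d d0 hd]; exists d => // s sab.
by apply: hd => I /sab[? ? ?]; split=> //; lra.
Qed.

Lemma abs_continuousB (R : realType) (V : normedModType R) (h g : R -> V)
    (a b : R) : abs_continuous a b h -> abs_continuous a b g ->
  abs_continuous a b (h \- g).
Proof.
move=> hAC gAC e e0.
have [d1 d10 hd] := hAC _ (ltac:(lra) : 0 < e / 2).
have [d2 d20 gd] := gAC _ (ltac:(lra) : 0 < e / 2).
exists (Num.min d1 d2); first by rewrite lt_min d10.
move=> s sab sp; rewrite lt_min => /andP[/(hd s sab sp) h1 /(gd s sab sp) g1].
rewrite (splitr e) (le_lt_trans _ (ltrD h1 g1))// -big_split/=.
apply: ler_sum => I _ /=.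
have -> : h I.2 - g I.2 - (h I.1 - g I.1) = (h I.2 - h I.1) - (g I.2 - g I.1).
  by rewrite !opprB addrACA [RHS]addrACA [- g _ - _]addrC.
exact: ler_normB.
Qed.

Lemma lipschitz_abs_continuous (R : realType) (V : normedModType R) (h : R -> V)
    (a b L : R) :
  (forall u w, a <= u -> u <= w -> w <= b -> `|h w - h u| <= L * (w - u)) ->
  abs_continuous a b h.
Proof.
move=> hL e e0; have L0 : 0 < `|L| + 1 by rewrite ltr_wpDl.
exists (e / (`|L| + 1)); first exact: divr_gt0.
move=> s sab sp; rewrite ltr_pdivlMr// mulrC; apply: le_lt_trans.
rewrite mulr_sumr big_seq [leRHS]big_seq; apply: ler_sum => I /sab[? ? ?].
rewrite (le_trans (hL _ _ _ _ _))// ler_wpM2r ?subr_ge0//.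
by rewrite (le_trans (ler_norm L))// lerDl.
Qed.

Lemma abs_continuous_within (R : realType) (V : normedModType R) (h : R -> V)
    (a b : R) : abs_continuous a b h -> {within `[a, b], continuous h}.
Proof.
move=> hAC; apply/subspace_continuousP => x; rewrite /= in_itv/= => /andP[ax xb].
apply/cvgrPdist_lt => e /hAC[d d0 hd].
rewrite near_withinE -[nbhs _]/(nbhs x); apply/nbhs_ballP; exists d => //= y.
rewrite /ball/= in_itv/= => xy /andP[ay yb].
have key u w : a <= u -> u <= w -> w <= b -> `|u - w| < d -> `|h w - h u| < e.
  move=> au uw wb uwd; have := hd [:: (u, w)]; rewrite !big_seq1/=; apply=> //.
  - by move=> I; rewrite inE => /eqP ->.
  - by rewrite -[ltLHS]ger0_norm ?subr_ge0// distrC.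
have [xley|/ltW ylex] := leP x y; first by rewrite distrC key.
by rewrite key// distrC.
Qed.

Lemma is_derive_cvg (R : numFieldType) (V : normedModType R) (h : R -> V)
    (t : R) (l : V) :
  k^-1 *: (h (k *: 1 + t) - h t) @[k --> 0^'] --> l -> is_derive t 1 h l.
Proof.
move=> hl; split; first exact: cvgP hl.
exact: cvg_lim hl.
Qed.

Lemma is_derive_scalel (R : numFieldType) (V : normedModType R) (w : V)
    (t : R) : is_derive t 1 (fun s => s *: w) w.
Proof.
apply: is_derive_cvg.
suff: (fun _ : R => w) @ (0 : R)^' --> w by apply: cvg_trans; apply: near_eq_cvg;
rewrite near_withinE; apply: nearW => k k0;
rewrite  -scalerBl addrK scalerA -[_ *: 1]/(k * 1) mulr1 mulVf ?scale1r.
exact: cvg_cst.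
Qed.

(** After subtraction of the linear map s *: v t, the derivative is almost everywhere of norm at
    most e near t, by continuity of v at t; the mean value inequality then bounds every difference
    quotient based at t. *)
Lemma abs_continuous_is_derive (R : realType) (V : normedModType R)
    (h v : R -> V) (a b t : R) : a < t < b -> abs_continuous a b h ->
  {ae @lebesgue_measure R, forall s, a <= s -> s <= b -> is_derive s 1 h (v s)} ->
  {for t, continuous v} -> is_derive t 1 h (v t).
Proof.
move=> /andP[at_ tb] hAC hv vt.
apply: is_derive_cvg; apply/cvgrPdist_le => e e0.
have /cvgrPdist_le/(_ e e0) := vt; rewrite -[nbhs _]/(nbhs t).
move=> /nbhs_ballP[r /= r0 rv].
pose g s := h s - s *: v t.
have key u w : a <= u -> u <= w -> w <= b -> `|u - t| < r -> `|w - t| < r ->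
    `|g w - g u| <= e * (w - u).
  move=> au uw wb ur wr; apply: abs_continuous_mean_value => //; first exact: ltW.
    apply: abs_continuousB; first exact: abs_continuous_sub hAC.
    apply: (@lipschitz_abs_continuous _ _ _ _ _ `|v t|) => x y _ xy _.
    by rewrite -scalerBl normrZ mulrC ger0_norm// subr_ge0.
  have [N [mN N0 hN]] := hv; exists N; split=> // s /= ns.
  apply: hN => /= hs; apply: ns => us sw.
  exists (v s - v t); last first.
    rewrite distrC; apply: rv; rewrite /ball/= distrC.
    by move: ur wr; rewrite !ltr_norml => /andP[? ?] /andP[? ?]; lra.
  have : is_derive s 1 h (v s) by apply: hs; lra.
  by move=> hds; apply: is_deriveB; exact: is_derive_scalel.
rewrite near_withinE -[nbhs _]/(nbhs (0:R)); apply/nbhs_ballP.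
exists (Num.min r (Num.min (t - a) (b - t))).
  by rewrite /= !lt_min r0 !subr_gt0 at_ tb.
move=> k; rewrite /ball/= sub0r normrN !lt_min => /and3P[kr kta kbt] k0.
have kb := le_lt_trans (ler_norm k) kbt.
have ka : - k < t - a by rewrite (le_lt_trans _ kta)// -normrN ler_norm.
have gk : `|g (k + t) - g t| <= e * `|k|.
  have [k0'|/ltW k0'] := leP 0 k.
    rewrite (ger0_norm k0') in kr *.
    have := @key t (k + t); rewrite addrK subrr normr0 (ger0_norm k0').
    by apply=> //; lra.
  have := @key (k + t) t; rewrite addrK subrr normr0 distrC.
  rewrite (_ : t - (k + t) = `|k|); last by rewrite (ler0_norm k0'); lra.
  by apply=> //; lra.
rewrite -[_ *: 1]/(k * 1) mulr1 distrC.
have -> : k^-1 *: (h (k + t) - h t) - v t = k^-1 *: (g (k + t) - g t).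
  rewrite /g -[in LHS](scale1r (v t)) -(mulVf k0) -scalerA -scalerBr.
  by congr (_ *: _); rewrite scalerDl opprB opprD !addrA addrNK addrAC.
by rewrite normrZ normfV ler_pdivrMl ?normr_gt0// mulrC.
Qed.

(** * Filippov solutions of continuous systems *)

Lemma closed_ball_convex (R : realType) (V : normedModType R) (p : V) (r : R) :
  0 < r -> convex_set (closed_ball p r : set (convex_lmodType V)).
Proof.
move=> r0; rewrite closed_ballE//; apply/convex_setW => x y.
rewrite !inE /closed_ball_/= => px py k k0 k1; rewrite inE/=.
rewrite -[conv _ _ _]/(k%:num *: x + (1 - k%:num) *: y).
set c := k%:num in k0 k1 *; have c0 := ltW k0.
have c1 : 0 <= 1 - c by rewrite subr_ge0 ltW.
have {1}-> : p = c *: p + (1 - c) *: p by rewrite -scalerDl subrKC scale1r.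
rewrite opprD addrACA -!scalerBr (le_trans (ler_normD _ _))// !normrZ.
rewrite (ger0_norm c0) (ger0_norm c1).
have -> : r = c * r + (1 - c) * r by ring.
by apply: lerD; rewrite ler_wpM2l.
Qed.

Lemma ball_not_negligible (R : realType) (p : R * R) (r : R) (N : set (R * R)) :
  0 < r -> ((@lebesgue_measure R) \x (@lebesgue_measure R))%E.-negligible N ->
  ball p r `\` N !=set0.
Proof.
move=> r0 [A [mA A0 NA]]; apply/set0P/eqP; rewrite setD_eq0 => bN.
have bE : ball p r = ball p.1 r `*` ball p.2 r by [].
have mb (x : R) : measurable (ball x r : set R) by apply: open_measurable; exact: ball_open.
have : (((@lebesgue_measure R) \x (@lebesgue_measure R)) (ball p r) <=
  ((@lebesgue_measure R) \x (@lebesgue_measure R)) A)%E.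
  apply: le_measure; rewrite ?inE//; first by rewrite bE; apply: measurableX; exact: mb.
  exact: subset_trans NA.
have mb0 (x : R) : (0 < lebesgue_measure (ball x r : set R))%E.
  by rewrite lebesgue_measure_ball ?ltW// lte_fin mulrn_wgt0.
rewrite [leRHS]A0 bE product_measure1E; [|exact: mb..].
rewrite leNgt => /negP; apply.
by apply: mule_gt0; exact: mb0.
Qed.

Lemma filippov_map_continuous (R : realType) (h : R * R -> R * R) (p : R * R) :
  {for p, continuous h} -> filippov_map h p = [set h p].
Proof.
move=> hp; apply/seteqP; split=> [v hv|_ ->].
  apply/eqP; rewrite -subr_eq0 -normr_le0; apply/ler_addgt0Pr => e e0.
  rewrite add0r distrC.
  have /cvgrPdist_le/(_ e e0) := hp; rewrite -[nbhs _]/(nbhs p).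
  move=> /nbhs_ballP[d /= d0 hd].
  have := hv d d0 set0 (negligible_set0 _) (closed_ball (h p) e).
  rewrite closed_ballE//; apply; split.
    split; first by rewrite -closed_ballE//; exact: closed_ball_closed.
    by rewrite -closed_ballE//; exact: closed_ball_convex.
  by move=> _ [q [/hd hq _] <-].
move=> d /= d0 N /= hN C [[Ccl _] hC].
apply: Ccl => B hB.
have /nbhs_ballP[r /= r0 rB] : nbhs p (h @^-1` B) by exact: hp.
have [q [pq Nq]] : ball p (Num.min d r) `\` N !=set0.
  by apply: ball_not_negligible hN; rewrite lt_min d0.
exists (h q); split.
  by apply: hC; exists q => //; split=> //; apply: le_ball pq; rewrite ge_min lexx.
by apply: rB; apply: le_ball pq; rewrite ge_min lexx orbT.
Qed.

(** * Calculus of pairs and of real powers *)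

Lemma is_derive_fst (R : realType) (h : R -> R * R) (t : R) (v : R * R) :
  is_derive t 1 h v -> is_derive t 1 (fst \o h) v.1.
Proof.
move=> [hd hv]; apply: is_derive_cvg.
have hl : k^-1 *: (h (k *: 1 + t) - h t) @[k --> 0^'] --> v.
  by rewrite -hv; exact: hd.
exact: (cvg_comp _ _ hl (@cvg_fst _ _ (nbhs v.1) (nbhs v.2) _)).
Qed.

Lemma is_derive_snd (R : realType) (h : R -> R * R) (t : R) (v : R * R) :
  is_derive t 1 h v -> is_derive t 1 (snd \o h) v.2.
Proof.
move=> [hd hv]; apply: is_derive_cvg.
have hl : k^-1 *: (h (k *: 1 + t) - h t) @[k --> 0^'] --> v.
  by rewrite -hv; exact: hd.
exact: (cvg_comp _ _ hl (@cvg_snd _ _ (nbhs v.1) (nbhs v.2) _)).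
Qed.

Lemma is_derive_pair (R : realType) (f g : R -> R) (t u v : R) :
  is_derive t 1 f u -> is_derive t 1 g v ->
  is_derive t 1 (fun s => (f s, g s)) (u, v).
Proof.
move=> [fd fu] [gd gv]; apply: is_derive_cvg.
apply: (@cvg_pair _ _ _ _ (nbhs u) (nbhs v)); first by rewrite -fu; exact: fd.
by rewrite -gv; exact: gd.
Qed.

Lemma sqr_powR (R : realType) (x p : R) : (x ^+ 2) `^ p = `|x| `^ (2 * p).
Proof. by rewrite -real_normK ?num_real// -powR_mulrn// -powRrM. Qed.

(** Writing |f|^p as (f^2)^(p/2) avoids a case distinction on the sign of f t. *)
Lemma is_derive_norm_powR (R : realType) (f : R -> R) (t df p : R) :
  f t != 0 -> is_derive t 1 f df ->
  is_derive t 1 (fun s => `|f s| `^ p) (p * `|f t| `^ (p - 2) * f t * df).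
Proof.
move=> ft0 fd.
have -> : (fun s => `|f s| `^ p) = (@powR R ^~ (p / 2)) \o (fun s => f s ^+ 2).
  by apply/funext => s /=; rewrite sqr_powR mulrC divfK// pnatr_eq0.
have f2 : 0 < f t ^+ 2 by rewrite exprn_even_gt0.
have f2d : is_derive t 1 (fun s => f s ^+ 2) (2 * f t * df).
  by apply: is_derive_eq; rewrite /GRing.scale/=; ring.
have := @is_derive1_comp _ (@powR R ^~ (p / 2)) _ t _ _
  (@is_derive1_powR R (p / 2) _ f2) f2d.
move=> H; apply: (is_derive_eq H).
rewrite sqr_powR (_ : 2 * (p / 2 - 1) = p - 2); last by field.
by field.
Qed.

Lemma continuous_norm_powR (R : realType) (p : R) : 0 < p ->
  continuous (fun x : R => `|x| `^ p).
Proof.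
move=> p0 x; have [->|x0] := eqVneq x 0; last first.
  apply/differentiable_continuous/derivable1_diffP.
  by apply: ex_derive; apply: (@is_derive_norm_powR _ id).
rewrite /continuous_at normr0 powR0 ?gt_eqF//; apply/cvgrPdist_lt => e e0.
apply/nbhs_ballP.
exists (e `^ p^-1); first exact: powR_gt0.
move=> y; rewrite /ball/= !sub0r !normrN => ye.
rewrite ger0_norm ?powR_ge0//.
have -> : e = (e `^ p^-1) `^ p by rewrite -powRrM mulVf ?gt_eqF// powRr1 ?ltW.
by apply: gt0_ltr_powR; rewrite // ?nnegrE ?powR_ge0.
Qed.

Lemma continuous_sig (R : realType) (p : R) : 0 < p -> continuous (@sig R p).
Proof.
move=> p0 x; have [x0|x0|->] := ltgtP x 0; last first.
- rewrite /continuous_at /sig sgr0 mulr0; apply/cvgrPdist_lt => e e0.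
  have := @continuous_norm_powR R p p0 0; rewrite /continuous_at normr0.
  rewrite powR0 ?gt_eqF// => /cvgrPdist_lt/(_ e e0); apply: filterS => y.
  rewrite !sub0r !normrN normrM; apply: le_lt_trans.
  by rewrite ler_piMr// normr_sg lern1 leq_b1.
- apply: cvg_trans (_ : `|y| `^ p @[y --> x] --> sig p x).
    apply: near_eq_cvg; near=> y; rewrite /sig gtr0_sg ?mulr1//.
    by near: y; exact: lt_nbhsr.
  by rewrite /sig gtr0_sg// mulr1; exact: continuous_norm_powR.
- apply: cvg_trans (_ : - (`|y| `^ p) @[y --> x] --> sig p x).
    apply: near_eq_cvg; near=> y; rewrite /sig ltr0_sg ?mulrN1//.
    by near: y; exact: lt_nbhsl.
  by rewrite /sig ltr0_sg// mulrN1; apply: cvgN; exact: continuous_norm_powR.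
Unshelve. all: by end_near. Qed.

Lemma le_of_is_derive_ge0 (R : realType) (f df : R -> R) (a b : R) : a <= b ->
  {within `[a, b], continuous f} ->
  (forall t, a < t < b -> is_derive t 1 f (df t)) ->
  (forall t, a < t < b -> 0 <= df t) -> f a <= f b.
Proof.
move=> ab fc fd df0; have [->//|ab'] := eqVneq a b.
have {}ab : a < b by rewrite lt_neqAle ab' ab.
have fd' t : t \in `]a, b[ -> is_derive t 1 f (df t) by rewrite in_itv; exact: fd.
have [c] := MVT ab fd' fc.
rewrite in_itv/= => cab fE; rewrite -subr_ge0 fE mulr_ge0 ?subr_ge0 ?(ltW ab)//.
exact: df0.
Qed.

Lemma eq_of_is_derive0 (R : realType) (f : R -> R) (a b : R) : a <= b ->
  {within `[a, b], continuous f} ->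
  (forall t, a < t < b -> is_derive t 1 f 0) -> f b = f a.
Proof.
move=> ab fc fd; apply/eqP; rewrite eq_le; apply/andP; split; last first.
  exact: (@le_of_is_derive_ge0 _ f (fun=> 0)).
rewrite -lerN2; apply: (@le_of_is_derive_ge0 _ (\- f) (fun=> 0)) => //.
- by move=> x; apply: continuousN; exact: fc.
- by move=> t /fd ?; apply: is_derive_eq; rewrite oppr0.
Qed.

Lemma filippov_solution_classical (R : realType) (f : R -> R -> R) (g : R -> R)
    (eps0 x0 c : R) (b : \bar R) (xi : R -> R * R) :
  continuous (fun p => (f p.1 p.2, g p.1)) -> 0 <= c -> (c%:E < b)%E ->
  filippov_solution (fun=> f) (fun=> g) eps0 x0 b xi ->
  {within `[0, c], continuous (fst \o xi)} /\
  {within `[0, c], continuous (snd \o xi)} /\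
  forall t, 0 < t < c ->
    is_derive t 1 (fst \o xi) (f (xi t).1 (xi t).2) /\
    is_derive t 1 (snd \o xi) (g (xi t).1).
Proof.
move=> Fc c0 cb [_ _ xiAC [N [mN N0 xid]]].
have ACc := xiAC _ c0 cb.
have xic := abs_continuous_within ACc.
split; [|split].
- by move=> x; apply: cvg_comp (xic x) _; exact: cvg_fst.
- by move=> x; apply: cvg_comp (xic x) _; exact: cvg_snd.
move=> t tc; have /andP[t0 tc'] := tc.
pose F := fun p : R * R => (f p.1 p.2, g p.1).
have xid' : is_derive t 1 xi ((F \o xi) t).
  apply: (abs_continuous_is_derive tc ACc).
    exists N; split=> // s /= ns; apply: xid => /= hs; apply: ns => s0 sc.
    have [|v vd] := hs s0; first by rewrite (le_lt_trans _ cb)// lee_fin.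
    by rewrite filippov_map_continuous; [move=> vE; rewrite /comp /F -vE|exact: Fc].
  apply: continuous_comp; last exact: Fc.
  by apply: (within_continuous_continuous _ xic); rewrite ?in_itv/= ?tc//; lra.
by split; [exact: (is_derive_fst xid')|exact: (is_derive_snd xid')].
Qed.

(** * The closed loop *)

(** Classical solutions, with derivatives at interior times only; continuity up to both ends lets
    the mean and intermediate value theorems reach 0 and c. The gains stay abstract, later tied
    together only by w^2 = a K m. *)
Definition closed_loop (R : realType) (a K m x0 c : R) (x e : R -> R) : Prop :=
  [/\ x 0 = x0, e 0 = 0,
      {within `[0, c], continuous x}, {within `[0, c], continuous e} &
      forall t, 0 < t < c ->
        is_derive t 1 x (- K * sig (1 - a) (x t) * e t) /\
        is_derive t 1 e (m * `|x t| `^ a)].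

Lemma closed_loop_sub (R : realType) (a K m x0 c d : R) (x e : R -> R) :
  d <= c -> closed_loop a K m x0 c x e -> closed_loop a K m x0 d x e.
Proof.
move=> dc [x0E e0E xc ec xed].
have sub : `[0, d] `<=` `[0, c].
  by move=> t; rewrite /= !in_itv/= => /andP[-> /le_trans]; apply.
split=> //; [exact: continuous_subspaceW xc|exact: continuous_subspaceW ec|].
by move=> t td; apply: xed; lra.
Qed.

Lemma closed_loop_eps_ge0 (R : realType) (a K m x0 t : R) (x e : R -> R) :
  0 < m -> 0 <= t ->
  closed_loop a K m x0 t x e -> 0 <= e t.
Proof.
move=> m0 t0 [_ e0 _ ec xed]; rewrite -e0.
apply: (le_of_is_derive_ge0 t0 ec) => s st; first exact: (xed _ st).2.
by rewrite mulr_ge0 ?powR_ge0// ltW.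
Qed.

Lemma mul_sig (R : realType) (p x : R) : x * sig p x = `|x| `^ p * `|x|.
Proof. by rewrite /sig mulrCA (mulrC x) -normrEsg. Qed.

(** The square of x has derivative - 2 K |x|^(1 - a) |x| e, nonpositive since e is nonnegative;
    unlike |x|, it is differentiable also where x vanishes. With x s = 0 this says that a zero is
    never left. *)
Lemma closed_loop_norm_le (R : realType) (a K m x0 s t : R) (x e : R -> R) :
  0 < K -> 0 < m -> 0 <= s -> s <= t ->
  closed_loop a K m x0 t x e -> `|x t| <= `|x s|.
Proof.
move=> K0 m0 s0 st sys; have [_ _ xc _ xed] := sys.
rewrite -ler_sqr ?nnegrE// !real_normK ?num_real// -lerN2.
pose dw u := 2 * K * (x u * sig (1 - a) (x u)) * e u.
apply: (@le_of_is_derive_ge0 _ (fun u => - x u ^+ 2) dw) => //.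
- have xc' : {within `[s, t], continuous x}.
    apply: continuous_subspaceW xc => u.
    by rewrite /= !in_itv/= => /andP[/(le_trans s0) ->].
  by move=> u; apply: cvgN; apply: cvgM; exact: xc'.
- move=> u sut; have [xd _] : _ /\ _ := xed u (ltac:(lra)).
  by apply: is_derive_eq; rewrite /dw /GRing.scale/=; ring.
- move=> u sut; rewrite /dw mul_sig.
  have eu : 0 <= e u.
    by apply: (@closed_loop_eps_ge0 _ a K m x0 _ x) => //; [lra|apply: closed_loop_sub sys; lra].
  by rewrite !mulr_ge0 ?powR_ge0// ltW.
Qed.

(* As long as [x] does not vanish, [y = |x|^a] and [e] solve the linear system
   [y' = - a K e], [e' = m y], for which
   [y cos (w t) + w / m e sin (w t)] and [y sin (w t) - w / m e cos (w t)]
   are first integrals. *)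
Lemma closed_loop_oscillator (R : realType) (a K m w x0 t : R) (x e : R -> R) :
  0 < a -> 0 < K -> 0 < m -> w ^+ 2 = a * K * m -> 0 <= t -> x t != 0 ->
  closed_loop a K m x0 t x e -> `|x t| `^ a = `|x0| `^ a * cos (w * t).
Proof.
move=> a0 K0 m0 w2 t0 xt sys; have [x0E e0E xc ec xed] := sys.
pose y s := `|x s| `^ a.
(* By monotonicity of |x|, a nonzero final value excludes every earlier zero. *)
have xn s : 0 <= s -> s <= t -> x s != 0.
  move=> s0 st; rewrite -normr_gt0 (lt_le_trans _ (closed_loop_norm_le K0 m0 s0 st sys))//.
  by rewrite normr_gt0.
have yd s : 0 < s < t -> is_derive s 1 y (- (a * K) * e s).
  move=> st; have [xd _] := xed s st.
  have xs : x s != 0 by apply: xn; lra.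
  apply: (is_derive_eq (is_derive_norm_powR a xs xd)).
  (* The exponents a - 2, 1 - a and 1 add up to 0: all powers of |x| cancel and y' is linear in
     e. *)
  have -> : a * `|x s| `^ (a - 2) * x s * (- K * sig (1 - a) (x s) * e s) =
    - (a * K) * e s * (`|x s| `^ (a - 2) * (x s * sig (1 - a) (x s))) by ring.
  rewrite mul_sig -[X in _ * (_ * (_ * X))]powRr1//.
  rewrite -!powRD ?normr_eq0 ?xs ?implybT//.
  by rewrite (_ : a - 2 + (1 - a + 1) = 0) ?powRr0 ?mulr1//; ring.
have yc : {within `[0, t], continuous y}.
  move=> s; apply: (@cvg_comp _ _ _ x (fun z => `|z| `^ a) _ _ _ (xc s)).
  exact: continuous_norm_powR.
have cd (s : R) : is_derive s 1 (fun u => cos (w * u)) (- sin (w * s) * w).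
  by apply: is_derive_eq; rewrite /GRing.scale/= mulr1.
have sd (s : R) : is_derive s 1 (fun u => sin (w * u)) (cos (w * s) * w).
  by apply: is_derive_eq; rewrite /GRing.scale/= mulr1.
have cc : {within `[0, t], continuous (fun u => cos (w * u))}.
  apply: derivable_within_continuous => s _; exact: ex_derive.
have sc : {within `[0, t], continuous (fun u => sin (w * u))}.
  apply: derivable_within_continuous => s _; exact: ex_derive.
have m0' : m != 0 by rewrite gt_eqF.
have aK : a * K = w ^+ 2 / m by rewrite w2 mulfK.
have y0E : y 0 = `|x0| `^ a by rewrite /y x0E.
pose A s := y s * cos (w * s) + w / m * e s * sin (w * s).
pose B s := y s * sin (w * s) - w / m * e s * cos (w * s).
have ec' : {within `[0, t], continuous (fun u => w / m * e u)}.
  by move=> s; apply: cvgM (ec s); exact: cvg_cst.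
have AE : A t = A 0.
  apply: eq_of_is_derive0 => //.
    by move=> s; apply: cvgD; [exact: (cvgM (yc s) (cc s))|exact: (cvgM (ec' s) (sc s))].
  move=> s st; have yds := yd s st; have [_ ed] := xed s st.
  by apply: is_derive_eq; rewrite /GRing.scale/= /y aK; field.
have BE : B t = B 0.
  apply: eq_of_is_derive0 => //.
    move=> s; apply: cvgD; first exact: (cvgM (yc s) (sc s)).
    by apply: cvgN; exact: (cvgM (ec' s) (cc s)).
  move=> s st; have yds := yd s st; have [_ ed] := xed s st.
  by apply: is_derive_eq; rewrite /GRing.scale/= /y aK; field.
move: AE BE; rewrite /A /B e0E y0E !mulr0 cos0 sin0 !mulr0 mul0r mulr1 addr0 subrr.
rewrite -/(y t) => <- BE.
(* Rotating back, y = A cos (w t) + B sin (w t), and B vanishes because e starts at 0. *)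
rewrite -[LHS]mulr1 -(cos2Dsin2 (w * t)).
have -> : y t * (cos (w * t) ^+ 2 + sin (w * t) ^+ 2) =
  A t * cos (w * t) + B t * sin (w * t) by rewrite /A /B; ring.
by rewrite [B t]BE mul0r addr0.
Qed.

(** This is |x|^a = |x0|^a cos (w t) solved for x with the sign of x0, frozen by the minimum at the
    quarter period T. The cosine is nonnegative on [0, T]; the absolute value gives the form |f|^p
    treated above. *)
Definition explicit_x (R : realType) (a w T x0 t : R) : R :=
  x0 * `|cos (w * Num.min t T)| `^ a^-1.

Lemma cos_quarter_gt0 (R : realType) (w T t : R) : 0 < w -> w * T = pi / 2 ->
  0 <= t -> t < T -> 0 < cos (w * t).
Proof.
move=> w0 wT t0 tT; apply: cos_gt0_pihalf.
rewrite -wT ltr_pM2l// tT andbT wT.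
by have := pi_gt0 R; have : 0 <= w * t by [rewrite mulr_ge0// ltW]; lra.
Qed.

Lemma explicit_x_eq0 (R : realType) (a w T x0 t : R) : 0 < a ->
  w * T = pi / 2 -> T <= t -> explicit_x a w T x0 t = 0.
Proof.
move=> a0 wT Tt; rewrite /explicit_x min_r// wT cos_pihalf normr0.
by rewrite powR0 ?mulr0// invr_neq0 ?gt_eqF.
Qed.

(** A state nonzero at some t >= T would be nonzero at T, where the oscillator formula gives cos (pi
    / 2) = 0. *)
Lemma closed_loop_neq0_lt (R : realType) (a K m w T x0 t : R) (x e : R -> R) :
  0 < a -> 0 < K -> 0 < m -> 0 < T -> w ^+ 2 = a * K * m -> w * T = pi / 2 ->
  0 <= t -> x t != 0 -> closed_loop a K m x0 t x e -> t < T.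
Proof.
move=> a0 K0 m0 T0 w2 wT t0 xt sys; rewrite ltNge; apply/negP => Tt.
have xT : x T != 0.
  by rewrite -normr_gt0 (lt_le_trans _ (closed_loop_norm_le K0 m0 (ltW T0) Tt sys)) ?normr_gt0.
have := closed_loop_oscillator a0 K0 m0 w2 (ltW T0) xT (closed_loop_sub Tt sys).
by rewrite wT cos_pihalf mulr0 => /powR_eq0_eq0/eqP; rewrite normr_eq0 (negbTE xT).
Qed.

(** The cosine formula says nothing at a zero of x, but it keeps all earlier nonzero values of |x|^a
    above |x0|^a cos (w t) > 0. Reaching 0 continuously would require crossing the gap below this
    bound. *)
Lemma closed_loop_neq0 (R : realType) (a K m w T x0 t : R) (x e : R -> R) :
  0 < a -> 0 < K -> 0 < m -> 0 < w -> w ^+ 2 = a * K * m -> w * T = pi / 2 ->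
  x0 != 0 -> 0 <= t -> t < T -> closed_loop a K m x0 t x e -> x t != 0.
Proof.
move=> a0 K0 m0 w0 w2 wT x00 t0 tT sys; apply/negP => /eqP xt.
have [x0E e0E xc ec xed] := sys.
have c0 := cos_quarter_gt0 w0 wT t0 tT.
have ax0 : 0 < `|x0| `^ a by rewrite powR_gt0 ?normr_gt0.
(* Half of that lower bound: a value inside the gap, which the intermediate value theorem forces
   |x|^a to take. *)
pose v := `|x0| `^ a * (cos (w * t) / 2).
have v0 : 0 < v by rewrite mulr_gt0// divr_gt0.
have [||s] := @IVT R (fun s => `|x s| `^ a) 0 t v t0.
- move=> s; apply: (@cvg_comp _ _ _ x (fun z => `|z| `^ a) _ _ _ (xc s)).
  exact: continuous_norm_powR.
- rewrite /= x0E xt normr0 powR0 ?gt_eqF// min_r ?max_l ?powR_ge0// (ltW v0)/=.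
  by rewrite ler_piMr ?powR_ge0// ler_pdivrMr// mul1r (le_trans (cos_le1 _))// ler1n.
rewrite in_itv/= => /andP[s0 st] vE.
have xs : x s != 0.
  by apply/eqP => xs0; move: v0; rewrite -vE xs0 normr0 powR0 ?gt_eqF// ltxx.
move: vE; rewrite (closed_loop_oscillator a0 K0 m0 w2 s0 xs (closed_loop_sub st sys)).
move=> /(mulfI (lt0r_neq0 ax0)) cE.
have : cos (w * t) <= cos (w * s).
  have pi0 := pi_gt0 R.
  have wt : w * t <= pi / 2 by rewrite -wT ler_pM2l// ltW.
  have ws : w * s <= w * t by rewrite ler_pM2l.
  have ws0 : 0 <= w * s by rewrite mulr_ge0// ltW.
  by rewrite leNgt ltr_cos ?in_itv/= ?ws0 -?leNgt//=; lra.
by rewrite cE; lra.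
Qed.

Lemma closed_loop_x (R : realType) (a K m w T x0 t : R) (x e : R -> R) :
  0 < a -> 0 < K -> 0 < m -> 0 < T -> 0 < w -> w ^+ 2 = a * K * m ->
  w * T = pi / 2 -> 0 <= t -> closed_loop a K m x0 t x e ->
  x t = explicit_x a w T x0 t.
Proof.
move=> a0 K0 m0 T0 w0 w2 wT t0 sys.
have [Tt|tT] := leP T t.
  rewrite explicit_x_eq0//; apply/eqP/negPn/negP => xt.
  by have := closed_loop_neq0_lt a0 K0 m0 T0 w2 wT t0 xt sys; rewrite ltNge Tt.
have [x0E _ xc _ _] := sys.
have norm_le0 s : 0 <= s -> s <= t -> x s = 0 -> x t = 0.
  move=> s0 st xs; apply/eqP; rewrite -normr_le0.
  by have := closed_loop_norm_le K0 m0 s0 st sys; rewrite xs normr0.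
have [x00|x00] := eqVneq x0 0.
  by rewrite /explicit_x x00 mul0r; apply: (norm_le0 0); rewrite // x0E.
have xt := closed_loop_neq0 a0 K0 m0 w0 w2 wT x00 t0 tT sys.
(* The oscillator formula determines only |x|; a change of sign would create a zero, which x could
   not leave. *)
have sgx : Num.sg (x t) = Num.sg x0.
  apply/eqP/negPn/negP => sgx.
  have [|s] := @IVT R x 0 t 0 t0 xc.
    rewrite x0E; move: sgx; rewrite ge_min le_max.
    by case: (sgrP x0) x00 => //; case: (sgrP (x t)) xt; rewrite ?eqxx//=;
      move=> h _ h' _ _; rewrite ?(ltW h) ?(ltW h') ?orbT.
  by rewrite in_itv/= => /andP[s0 st] /(norm_le0 _ s0 st)/eqP; rewrite (negbTE xt).
rewrite /explicit_x min_l ?ltW// (ger0_norm (ltW (cos_quarter_gt0 w0 wT t0 tT))).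
rewrite [LHS]numEsg sgx [x0 in RHS]numEsg -mulrA; congr (_ * _).
have aV p : 0 <= p -> p = (p `^ a) `^ a^-1.
  by move=> p0; rewrite -powRrM mulfV ?gt_eqF// powRr1.
rewrite [LHS]aV// (closed_loop_oscillator a0 K0 m0 w2 t0 xt sys).
by rewrite powRM ?powR_ge0 ?ltW ?(cos_quarter_gt0 w0 wT t0 tT)// -aV.
Qed.

(** * Existence of the explicit solution, and its uniqueness *)

Lemma lipschitz_is_derive (R : realType) (f df : R -> R) (a b L : R) : a <= b ->
  {within `[a, b], continuous f} ->
  (forall t, a < t < b -> is_derive t 1 f (df t)) ->
  (forall t, a < t < b -> `|df t| <= L) -> `|f b - f a| <= L * (b - a).
Proof.
move=> ab fc fd dfL; have [<-|ab'] := eqVneq a b; first by rewrite !subrr normr0 mulr0.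
have {}ab : a < b by rewrite lt_neqAle ab' ab.
have fd' t : t \in `]a, b[ -> is_derive t 1 f (df t) by rewrite in_itv; exact: fd.
have [c] := MVT ab fd' fc.
rewrite in_itv/= => cab ->; rewrite normrM (gtr0_norm (_ : 0 < b - a)) ?subr_gt0//.
by rewrite ler_wpM2r ?subr_ge0 ?(ltW ab)//; exact: dfL.
Qed.

(** The integral of m |x|^a = m |x0|^a cos (w s) from 0, constant once x has reached 0 at T. *)
Definition explicit_e (R : realType) (a m w T x0 t : R) : R :=
  m / w * `|x0| `^ a * sin (w * Num.min t T).

Lemma is_derive_cosM (R : realType) (w t : R) :
  is_derive t 1 (fun s => cos (w * s)) (- (w * sin (w * t))).
Proof. by apply: is_derive_eq; rewrite /GRing.scale/=; ring. Qed.

Lemma is_derive_sinM (R : realType) (w t : R) :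
  is_derive t 1 (fun s => sin (w * s)) (w * cos (w * t)).
Proof. by apply: is_derive_eq; rewrite /GRing.scale/=; ring. Qed.

Lemma is_derive_cos_powR (R : realType) (p w t : R) : 0 < cos (w * t) ->
  is_derive t 1 (fun s => `|cos (w * s)| `^ p)
    (- (p * w * cos (w * t) `^ (p - 1) * sin (w * t))).
Proof.
move=> c0; have c0' := lt0r_neq0 c0.
apply: (is_derive_eq (is_derive_norm_powR p c0' (is_derive_cosM w t))).
rewrite (gtr0_norm c0) (_ : p - 1 = p - 2 + 1); last by ring.
by rewrite (@powRD _ _ (p - 2) 1) ?c0' ?implybT// powRr1 ?(ltW c0)//; ring.
Qed.

(** The derivative carries the factor cos^(p - 1), at most 1 because p >= 1; this is applied with p
    = 1/a, where a < 1 enters. *)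
Lemma cos_powR_lipschitz (R : realType) (p w T u v : R) : 1 <= p -> 0 < w ->
  w * T = pi / 2 -> 0 <= u -> u <= v -> v <= T ->
  `| `|cos (w * v)| `^ p - `|cos (w * u)| `^ p| <= p * w * (v - u).
Proof.
move=> p1 w0 wT u0 uv vT.
have p0 : 0 < p by rewrite (lt_le_trans _ p1).
have c0 t : u < t < v -> 0 < cos (w * t).
  by move=> tuv; apply: (cos_quarter_gt0 w0 wT); lra.
apply: (@lipschitz_is_derive _ (fun t => `|cos (w * t)| `^ p)
  (fun t => - (p * w * cos (w * t) `^ (p - 1) * sin (w * t)))) => //.
- apply: continuous_subspaceT => t.
  apply: (@cvg_comp _ _ _ (fun t => cos (w * t)) (fun z => `|z| `^ p)).
    apply: (@continuous_comp _ _ _ ( *%R w) cos); first exact: mulrl_continuous.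
    exact: continuous_cos.
  exact: continuous_norm_powR.
- by move=> t /c0; exact: is_derive_cos_powR.
- move=> t /c0 ct; have pw0 : 0 <= p * w by rewrite mulr_ge0 ?(ltW p0) ?(ltW w0).
  rewrite normrN !normrM -normrM (ger0_norm pw0) -mulrA ler_piMr//.
  rewrite mulr_ile1// ?sin_max// ger0_norm ?powR_ge0//.
  rewrite -[leRHS](powRr0 (cos (w * t))); apply: ger_powR.
    by rewrite ct cos_le1.
  by rewrite subr_ge0.
Qed.

Lemma min_lipschitz (R : realType) (T u v : R) : u <= v ->
  Num.min u T <= Num.min v T /\ Num.min v T - Num.min u T <= v - u.
Proof. by move=> uv; case: (leP u T); case: (leP v T); lra. Qed.

Lemma explicit_abs_continuous (R : realType) (a m w T x0 c : R) : 0 < a ->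
  a < 1 -> 0 < w -> 0 < T -> w * T = pi / 2 ->
  abs_continuous 0 c (fun t => (explicit_x a w T x0 t, explicit_e a m w T x0 t)).
Proof.
move=> a0 a1 w0 T0 wT.
pose L1 := `|x0| * (a^-1 * w); pose L2 := `|m / w * `|x0| `^ a| * w.
apply: (@lipschitz_abs_continuous _ _ _ _ _ (Num.max L1 L2)) => u v u0 uv _.
have [uv' duv] := min_lipschitz T uv.
have u0' : 0 <= Num.min u T by rewrite le_min u0 ltW.
have vT : Num.min v T <= T by rewrite ge_min lexx orbT.
have L10 : 0 <= L1 by rewrite !mulr_ge0 ?invr_ge0 ?(ltW a0) ?(ltW w0).
have L20 : 0 <= L2 by rewrite !mulr_ge0 ?(ltW w0).
rewrite prod_normE/= ge_max; apply/andP; split.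
- rewrite -mulrBr normrM (@le_trans _ _ (L1 * (v - u)))//.
    rewrite -mulrA ler_wpM2l// (le_trans (cos_powR_lipschitz _ w0 wT u0' uv' vT))//.
      by rewrite invf_ge1// ltW.
    by rewrite ler_wpM2l// mulr_ge0 ?invr_ge0 ?(ltW a0) ?(ltW w0).
  by rewrite ler_wpM2r ?subr_ge0// le_max lexx.
- rewrite -mulrBr normrM (@le_trans _ _ (L2 * (v - u)))//.
    rewrite /L2 -[leRHS]mulrA ler_wpM2l//.
    apply: (@le_trans _ _ (w * (Num.min v T - Num.min u T))); last first.
      by rewrite ler_wpM2l// ltW.
    apply: (@lipschitz_is_derive _ (fun t => sin (w * t)) (fun t => w * cos (w * t))) => //.
    + apply: derivable_within_continuous => t _; exact: ex_derive.
    + by move=> t _; exact: is_derive_sinM.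
    + by move=> t _; rewrite normrM (gtr0_norm w0) ler_piMr ?(ltW w0)// cos_max.
  by rewrite ler_wpM2r ?subr_ge0// le_max lexx orbT.
Qed.

(** Away from T the minimum is resolved on a whole neighbourhood of t, leaving a trigonometric
    formula or a constant; the single time T goes into the null set. *)
Lemma explicit_derive (R : realType) (a K m w T x0 t : R) : 0 < a ->
  0 < w -> 0 < T -> w ^+ 2 = a * K * m -> w * T = pi / 2 -> 0 < t -> t != T ->
  is_derive t 1 (fun s => (explicit_x a w T x0 s, explicit_e a m w T x0 s))
    (- K * sig (1 - a) (explicit_x a w T x0 t) * explicit_e a m w T x0 t,
     m * `|explicit_x a w T x0 t| `^ a).
Proof.
move=> a0 w0 T0 w2 wT t0; rewrite neq_lt => /orP[tT|Tt]; last first.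
  rewrite (explicit_x_eq0 x0 a0 wT (ltW Tt)) normr0 powR0 ?gt_eqF//.
  rewrite /sig sgr0 !(mulr0, mul0r).
  apply: (@near_eq_is_derive _ _ _
    (fun=> (explicit_x a w T x0 t, explicit_e a m w T x0 t))).
    near=> s; have Ts : T < s by near: s; exact: lt_nbhsr.
    by rewrite /explicit_x /explicit_e !(min_r (ltW Ts), min_r (ltW Tt)).
have c0 := cos_quarter_gt0 w0 wT (ltW t0) tT.
have w0' := lt0r_neq0 w0; have a0' := lt0r_neq0 a0.
apply: (@near_eq_is_derive _ _ _ (fun s => (x0 * `|cos (w * s)| `^ a^-1,
    m / w * `|x0| `^ a * sin (w * s)))).
  near=> s; have sT : s < T by near: s; exact: lt_nbhsl.
  by rewrite /explicit_x /explicit_e !(min_l (ltW sT)).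
have cd := is_derive_cos_powR a^-1 c0; have sd := is_derive_sinM w t.
rewrite /explicit_x /explicit_e !(min_l (ltW tT)).
apply: is_derive_pair; apply: is_derive_eq; rewrite /GRing.scale/= ?mulr0 ?addr0.
- have [->|x00] := eqVneq x0 0; first by rewrite /sig !mul0r sgr0 !(mulr0, mul0r).
  have ax0 : `|x0| != 0 by rewrite normr_eq0.
  rewrite /sig normrM sgrM (ger0_norm (powR_ge0 _ _)) (gtr0_norm c0).
  rewrite (gtr0_sg (powR_gt0 _ c0)) powRM ?powR_ge0// -powRrM mulr1.
  rewrite mulrBr mulr1 mulVf//; set C := cos _ `^ _.
  (* The gains enter x' only through this product, and |x0|^(1 - a) |x0|^a = |x0| makes the
     right-hand side linear in x0. *)
  have KmE : K * m = w ^+ 2 / a by rewrite w2; field.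
  have -> : - K * (`|x0| `^ (1 - a) * C * Num.sg x0) *
      (m / w * `|x0| `^ a * sin (w * t)) = - (K * m) / w *
      (Num.sg x0 * (`|x0| `^ (1 - a) * `|x0| `^ a)) * C * sin (w * t) by ring.
  rewrite -powRD ?ax0 ?implybT// subrK powRr1// -numEsg KmE.
  by field; rewrite w0' a0'.
- rewrite normrM (ger0_norm (powR_ge0 _ _)) powRM ?powR_ge0// -powRrM.
  by rewrite mulVf// powRr1// (gtr0_norm c0); field.
Unshelve. all: by end_near. Qed.

Lemma continuous_closed_loop_field (R : realType) (a K m : R) : 0 < a -> a < 1 ->
  continuous (fun p : R * R =>
    (- K * sig (1 - a) p.1 * p.2, m * `|p.1| `^ a)).
Proof.
move=> a0 a1 p.
apply: (@cvg_pair _ _ _ _ (nbhs _) (nbhs _)).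
  apply: cvgM; last exact: cvg_snd.
  apply: cvgM; first exact: cvg_cst.
  apply: (@cvg_comp _ _ _ fst (sig (1 - a))); first exact: cvg_fst.
  by apply: continuous_sig; rewrite subr_gt0.
apply: cvgM; first exact: cvg_cst.
apply: (@cvg_comp _ _ _ fst (fun z => `|z| `^ a)); first exact: cvg_fst.
exact: continuous_norm_powR.
Qed.

Lemma explicit_filippov (R : realType) (a K m w T x0 : R) :
  0 < a -> a < 1 -> 0 < w -> 0 < T -> w ^+ 2 = a * K * m -> w * T = pi / 2 ->
  filippov_solution (fun _ x e => - K * sig (1 - a) x * e)
    (fun _ x => m * `|x| `^ a) 0 x0 +oo%E
    (fun t => (explicit_x a w T x0 t, explicit_e a m w T x0 t)).
Proof.
move=> a0 a1 w0 T0 w2 wT; split=> //.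
- rewrite /explicit_x /explicit_e min_l ?(ltW T0)// mulr0 cos0 sin0 normr1.
  by rewrite powR1 mulr1 mulr0.
- by move=> c _ _; exact: explicit_abs_continuous.
have n1 (z : R) : (@lebesgue_measure R).-negligible [set z].
  by exists [set z]; split=> //; exact: lebesgue_measure_set1.
have nT : (@lebesgue_measure R).-negligible ([set 0] `|` [set T]).
  exact: negligibleU.
case: nT => N [mN N0 hN]; exists N; split=> // t /= nt; apply: hN => /=.
apply: contrapT => /not_orP[t0 tT]; apply: nt => t0' _.
eexists; first apply: (@explicit_derive _ a K m w T x0 t) => //.
- by rewrite lt_neqAle t0' eq_sym andbT; apply/eqP.
- exact/eqP.
- by rewrite filippov_map_continuous//; exact: continuous_closed_loop_field.
Qed.

(** Once x is known, e' = m |x|^a is a known function of time, so e and its explicit counterpart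
    differ by a constant, which is 0 at time 0. An arbitrary b serves global solutions and
    continuation alike. *)
Lemma filippov_explicit (R : realType) (a K m w T x0 t : R) (b : \bar R)
    (xi : R -> R * R) :
  0 < a -> a < 1 -> 0 < K -> 0 < m -> 0 < w -> 0 < T ->
  w ^+ 2 = a * K * m -> w * T = pi / 2 -> 0 <= t -> (t%:E < b)%E ->
  filippov_solution (fun _ x e => - K * sig (1 - a) x * e)
    (fun _ x => m * `|x| `^ a) 0 x0 b xi ->
  xi t = (explicit_x a w T x0 t, explicit_e a m w T x0 t).
Proof.
move=> a0 a1 K0 m0 w0 T0 w2 wT t0 tb sol.
have Fc := @continuous_closed_loop_field _ _ K m a0 a1.
have [_ xi0 _ _] := sol.
have [xc [ec xed]] := filippov_solution_classical
  (f := fun x e => - K * sig (1 - a) x * e) (g := fun x => m * `|x| `^ a)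
  Fc t0 tb sol.
have sys : closed_loop a K m x0 t (fst \o xi) (snd \o xi).
  by split=> //; rewrite /= xi0.
have xE s : 0 <= s -> s <= t -> (xi s).1 = explicit_x a w T x0 s.
  move=> s0 st.
  exact: (closed_loop_x a0 K0 m0 T0 w0 w2 wT s0 (closed_loop_sub st sys)).
have sol' := explicit_filippov x0 a0 a1 w0 T0 w2 wT.
have [_ [ec' xed']] := filippov_solution_classical
  (f := fun x e => - K * sig (1 - a) x * e) (g := fun x => m * `|x| `^ a)
  Fc t0 (ltry _) sol'.
rewrite [LHS]surjective_pairing xE//; congr (_, _).
apply/eqP; rewrite -subr_eq0; apply/eqP.
rewrite (_ : 0 = (xi 0).2 - explicit_e a m w T x0 0); last first.
  by rewrite xi0 /explicit_e min_l ?(ltW T0)// mulr0 sin0 mulr0 subrr.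
apply: (@eq_of_is_derive0 _ (fun s => (xi s).2 - explicit_e a m w T x0 s)) => //.
  by move=> s; apply: cvgB; [exact: ec|exact: ec'].
move=> s st; have [_ ed] := xed s st; have [_ ed'] := xed' s st.
apply: (is_derive_eq (is_deriveB ed ed')) => /=.
by rewrite xE ?subrr//; lra.
Qed.

(** * Stability and the settling time *)

Lemma explicit_x_norm_le (R : realType) (a w T x0 t : R) : 0 < a ->
  `|explicit_x a w T x0 t| <= `|x0|.
Proof.
move=> a0; rewrite normrM ler_piMr// ger0_norm ?powR_ge0//.
rewrite [leRHS](_ : 1 = 1 `^ a^-1); last by rewrite powR1.
rewrite ge0_ler_powR ?nnegrE ?invr_ge0 ?(ltW a0)//.
exact: cos_max.
Qed.

Lemma settling_time_explicit (R : realType) (a m w T x0 : R) : 0 < a -> 0 < w ->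
  0 < T -> w * T = pi / 2 -> x0 != 0 ->
  forall xi : R -> R * R, (forall t, 0 <= t -> (xi t).1 = explicit_x a w T x0 t) ->
  settling_time xi = T.
Proof.
move=> a0 w0 T0 wT x00 xi xiE.
pose S := [set tau : R | 0 <= tau /\ forall t, tau <= t -> (xi t).1 = 0].
have ST : S T.
  split=> [|t Tt]; first exact: ltW.
  by rewrite xiE ?(le_trans (ltW T0))// explicit_x_eq0.
apply/eqP; rewrite eq_le; apply/andP; split.
  by apply: ge_inf => //; exists 0 => tau [].
apply: lb_le_inf; first by exists T.
move=> tau [tau0 /(_ _ (lexx _))]; rewrite xiE// leNgt => xtau; apply/negP => tauT.
move: xtau; rewrite /explicit_x min_l ?ltW// => /eqP.
rewrite mulf_eq0 (negbTE x00)/= powR_eq0 normr_eq0.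
by rewrite gt_eqF// (cos_quarter_gt0 w0 wT).
Qed.

Theorem theorem1 (R : realType) (T alpha : R)
    (T_gt0 : 0 < T) (alpha_gt0 : 0 < alpha) (alpha_lt1 : alpha < 1) :
  EFxTS
    (fun _ x eps : R =>
       - (pi / (2 `^ (1 - alpha / 2) * alpha * T)) * sig (1 - alpha) x * eps)
    (fun _ x : R => pi / (2 `^ (1 + alpha / 2) * T) * `|x| `^ alpha)
    0 T.
Proof.
set K := pi / (2 `^ (1 - _) * _ * _); set m := pi / _.
pose w := pi / (2 * T).
have pi0 := pi_gt0 R.
have K0 : 0 < K by rewrite divr_gt0// !mulr_gt0 ?powR_gt0.
have m0 : 0 < m by rewrite divr_gt0// !mulr_gt0 ?powR_gt0.
have w0 : 0 < w by rewrite divr_gt0// mulr_gt0.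
have wT : w * T = pi / 2 by rewrite /w; field; rewrite gt_eqF.
have w2 : w ^+ 2 = alpha * K * m.
  (* The exponents of 2 in the two gains add up to 2; the resulting 4 is the square of the 2 in w =
     pi / (2 T). *)
  have p4 : 2 `^ (1 - alpha / 2) * 2 `^ (1 + alpha / 2) = 4 :> R.
    rewrite -powRD ?pnatr_eq0 ?implybT//.
    by rewrite (_ : _ + _ = 2%:R) ?powR_mulrn//; ring.
  have p1 : 2 `^ (1 - alpha / 2) != 0 :> R by rewrite gt_eqF ?powR_gt0.
  have p2 : 2 `^ (1 + alpha / 2) != 0 :> R by rewrite gt_eqF ?powR_gt0.
  have -> : alpha * K * m =
      pi ^+ 2 / (2 `^ (1 - alpha / 2) * 2 `^ (1 + alpha / 2) * T ^+ 2).
    by rewrite /K /m; field; rewrite p1 p2 !gt_eqF.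
  by rewrite p4 /w; field; rewrite gt_eqF.
pose sol x0 t := (explicit_x alpha w T x0 t, explicit_e alpha m w T x0 t).
have solP x0 := explicit_filippov x0 alpha_gt0 alpha_lt1 w0 T_gt0 w2 wT.
have uniq x0 b xi t := @filippov_explicit R alpha K m w T x0 t b xi
  alpha_gt0 alpha_lt1 K0 m0 w0 T_gt0 w2 wT.
have xE x0 xi t : global_solution (fun _ x eps => - K * sig (1 - alpha) x * eps)
    (fun _ x => m * `|x| `^ alpha) 0 x0 xi ->
    0 <= t -> (xi t).1 = explicit_x alpha w T x0 t.
  by move=> xiP t0; rewrite (uniq _ _ _ _ t0 (ltry _) xiP).
(* From x0 = 0 the state never moves, so its settling time is 0; the value T is required only for
   nonzero x0. *)
exists (fun x0 => if x0 == 0 then 0 else T); split; last first.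
  move=> x0 x00; rewrite (negbTE x00); split=> // xi xiP.
  by apply: (@settling_time_explicit _ alpha m w T x0) => // t; exact: xE.
split; last by move=> x0; case: ifP => // _; exact: ltW.
split.
- split; first by move=> x0; exists (sol x0); exact: solP.
  move=> x0 b xi xiP; exists (sol x0); first exact: solP.
  move=> t /andP[t0 tb].
  by rewrite (uniq _ _ _ _ t0 _ xiP).
- split.
    move=> e e0; exists e => // x0 xi x0e xiP t t0.
    by rewrite (xE _ _ _ xiP t0) (le_lt_trans (explicit_x_norm_le _ _ _ _ _)).
  move=> e e0; exists e => // x0 xi x0e xiP t t0.
  by rewrite (xE _ _ _ xiP t0) (le_lt_trans (explicit_x_norm_le _ _ _ _ _)).
- by move=> x0; case: ifP => // _; exact: ltW.
- move=> x0 xi xiP t; case: eqVneq => [x00 t0|_ Tt].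
    by rewrite (xE _ _ _ xiP t0) /explicit_x x00 mul0r.
  by rewrite (xE _ _ _ xiP (le_trans (ltW T_gt0) Tt)) explicit_x_eq0.
Qed.
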